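(* There is a $2$-DFAO with $204$ states that, for all integers $n \geq 1$ and $s \geq 0$, on input the pair $(n,s)$ written in base $2$, outputs $\mathrm{cce}(\mathbf{t}[s..s+n-1])$, the circular critical exponent of the length-$n$ factor of the Thue-Morse word $\mathbf{t}$ starting at position $s$.
   Context: The Thue-Morse word $\mathbf{t} = t_0 t_1 t_2 \cdots = 01101001\cdots$ is the infinite fixed point, starting with $0$, of the morphism $\mu$ with $\mu(0)=01$, $\mu(1)=10$. The notation $\mathbf{t}[i..j]$ means $t_i t_{i+1}\cdots t_j$. A nonempty finite word $w$ (indexed from $0$) has period $p$, where $1 \le p \le |w|$, if $w[i]=w[i+p]$ for all $i$ with $0 \le i < |w|-p$. The smallest period of $w$ is denoted $p(w)$, and the exponent of $w$ is $\exp(w) = |w|/p(w)$. A factor of a word is a contiguous block inside it. The conjugates of a finite word $w$ are its cyclic shifts, i.e. the words $yx$ with $w = xy$ ($x,y$ possibly empty). The circular critical exponent $\mathrm{cce}(w)$ of a nonempty finite word $w$ is the supremum (maximum) of $\exp(x)$ over all nonempty factors $x$ of all conjugates of $w$. A DFAO (deterministic finite automaton with output) is $M=(Q,\Sigma,\delta,q_0,\Delta,\tau)$, where $Q$ is a finite nonempty set of states, $\Sigma$ is the finite input alphabet, $\delta:Q\times\Sigma\to Q$ is the transition function (extended to $Q\times\Sigma^*$ in the usual way), $q_0\in Q$ is the initial state, $\Delta$ is the (finite) output alphabet (here a finite set of rational numbers), and $\tau:Q\to\Delta$ is the output map. On input $x \in \Sigma^*$ it outputs $\tau(\delta(q_0,x))$.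 A $2$-DFAO taking a pair $(n,s)$ as input has input alphabet $\Sigma=\{0,1\}\times\{0,1\}$: the base-$2$ representations of $n$ and $s$, the shorter one padded with leading zeros to the length of the longer one, are read in parallel, starting with the most significant digits. *)

(* Defs.v *)
From HB Require Import structures.
From mathcomp Require Import all_boot all_order all_algebra.

Set Implicit Arguments.
Unset Strict Implicit.
Unset Printing Implicit Defensive.

Import Order.TTheory GRing.Theory Num.Theory.

(* Binary letters and digits: false is 0 and true is 1. *)

Definition mu (a : bool) : seq bool := [:: a; ~~ a].

Definition morph (A B : Type) (h : A -> seq B) (w : seq A) : seq B :=
  flatten (map h w).

(* t = lim_k mu^k(0).  As mu^k(0) is a prefix of t of length 2 ^ k > k, its
   letter number k is t_k; thue_morse_fixed and thue_morse_unique below say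
   that t is the fixed point of mu that starts with 0. *)
Definition thue_morse (k : nat) : bool :=
  nth false (iter k (morph mu) [:: false]) k.

(* u[i..j], both ends included. *)
Definition block (A : Type) (u : nat -> A) (i j : nat) : seq A :=
  [seq u k | k <- iota i (j.+1 - i)].

Definition mu_fixed (u : nat -> bool) : Prop :=
  forall k, morph mu (mkseq u k) = mkseq u k.*2.

Lemma morph_mu_rcons w a : morph mu (rcons w a) = morph mu w ++ mu a.
Proof. by rewrite /morph map_rcons flatten_rcons. Qed.

Lemma mu_fixedP (u : nat -> bool) :
  mu_fixed u <-> forall k, u k.*2 = u k /\ u k.*2.+1 = ~~ u k.
Proof.
have mkS (k : nat) : mkseq u k.+1 = rcons (mkseq u k) (u k).
  by rewrite /mkseq -addn1 iotaD map_cat cats1.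
have mkSS (k : nat) : mkseq u k.+1.*2 = mkseq u k.*2 ++ [:: u k.*2; u k.*2.+1].
  by rewrite doubleS !mkS -!cats1 -catA.
split=> [fu k | fu].
  have := fu k.+1; rewrite mkS morph_mu_rcons fu mkSS => /eqP.
  by rewrite eqseq_cat // eqxx /= => /eqP[<- <-].
elim=> [|k IH]; first by rewrite /morph.
by rewrite mkS morph_mu_rcons IH mkSS /mu; case: (fu k) => -> ->.
Qed.

Lemma nth_morph_mu w k : k < size w ->
  nth false (morph mu w) k.*2 = nth false w k /\
  nth false (morph mu w) k.*2.+1 = ~~ nth false w k.
Proof. by elim: w k => [|a w IH] [|k] //= /IH. Qed.

Lemma size_iter_mu k : size (iter k (morph mu) [:: false]) = 2 ^ k.
Proof.
have sz w : size (morph mu w) = (size w).*2.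
  by elim: w => //= a w IH; rewrite -[in LHS]/(morph mu w) IH doubleS.
by elim: k => //= k IH; rewrite sz IH expnS mul2n.
Qed.

Lemma nth_iter_mu j k i : i < 2 ^ j -> j <= k ->
  nth false (iter k (morph mu) [:: false]) i =
  nth false (iter j (morph mu) [:: false]) i.
Proof.
elim: j k i => [|j IH] [|k] i //.
  rewrite expn0; case: i => // _ _.
  elim: k => // k IHk; rewrite iterS.
  have [|E _] := @nth_morph_mu (iter k.+1 (morph mu) [:: false]) 0.
    by rewrite size_iter_mu expn_gt0.
  by rewrite (E : nth _ _ 0 = _) IHk.
rewrite ltnS => lti lejk; rewrite !iterS.
have lti2 : i./2 < 2 ^ j by rewrite ltn_half_double -mul2n -expnS.
have [|Ek Ok] := @nth_morph_mu (iter k (morph mu) [:: false]) i./2.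
  by rewrite size_iter_mu (leq_trans lti2) // leq_exp2l.
have [|Ej Oj] := @nth_morph_mu (iter j (morph mu) [:: false]) i./2.
  by rewrite size_iter_mu.
rewrite -(odd_double_half i); case: (odd i); rewrite ?add0n ?add1n.
  by rewrite Ok Oj (IH k).
by rewrite Ek Ej (IH k).
Qed.

Lemma thue_morseE j i : i < 2 ^ j ->
  thue_morse i = nth false (iter j (morph mu) [:: false]) i.
Proof.
move=> lti; rewrite /thue_morse; case: (leqP j i) => [le|/ltnW le].
  by rewrite (nth_iter_mu lti).
by rewrite (nth_iter_mu (ltn_expl i (ltnSn 1)) le).
Qed.

Lemma thue_morse_fixed : thue_morse 0 = false /\ mu_fixed thue_morse.
Proof.
split=> //; apply/mu_fixedP => k.
have ltk := ltn_expl k (ltnSn 1).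
have [|E O] := @nth_morph_mu (iter k (morph mu) [:: false]) k.
  by rewrite size_iter_mu.
have lt2 : k.*2.+1 < 2 ^ k.+1 by rewrite expnS mul2n ltn_Sdouble.
rewrite (thue_morseE lt2) (thue_morseE (ltnW lt2)) (thue_morseE ltk) iterS.
by rewrite E O.
Qed.

Lemma thue_morse_unique (u : nat -> bool) :
  u 0 = false -> mu_fixed u -> u =1 thue_morse.
Proof.
have [t0 /mu_fixedP ft] := thue_morse_fixed => u0 /mu_fixedP fu k.
have [m] := ubnP k; elim: m k => // m IH [|k]; first by rewrite u0.
rewrite ltnS => ltm; have ltk : k.+1./2 < m.
  by apply: leq_trans ltm; rewrite ltn_half_double -addnn addSn ltnS leq_addl.
have [[eu ou] [et ot]] := (fu k.+1./2, ft k.+1./2).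
rewrite -(odd_double_half k.+1); case: (odd _); rewrite ?add0n ?add1n.
  by rewrite ou ot IH.
by rewrite eu et IH.
Qed.

Section Exponents.
Variable A : eqType.
Implicit Types w x y c : seq A.

Definition has_period w (p : nat) : bool :=
  (0 < p <= size w) && [forall i : 'I_(size w - p), onth w i == onth w (i + p)].

(* For w nonempty, ord_max = size w is a period; the value at [::] is 0. *)
Definition smallest_period w : nat :=
  [arg min_(p < ord_max : 'I_(size w).+1 | has_period w p) (p : nat)].

Definition exponent w : rat := ((size w)%:R / (smallest_period w)%:R)%R.

Definition nonempty_factors w : seq (seq A) :=
  [seq take l (drop i w) | i <- iota 0 (size w), l <- iota 1 (size w - i)].

Definition conjugates w : seq (seq A) :=
  [seq rot k w | k <- iota 0 (size w).+1].

(* Exponents are nonnegative, so the default value 0 is harmless. *)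
Definition cce w : rat :=
  \big[Order.max/0%R]_(c <- conjugates w)
    \big[Order.max/0%R]_(x <- nonempty_factors c) exponent x.

Lemma has_period_size w : w != [::] -> has_period w (size w).
Proof.
rewrite /has_period leqnn andbT -size_eq0 -lt0n => -> /=.
by apply/forallP => -[i]; rewrite subnn.
Qed.

Lemma smallest_periodP w : w != [::] ->
  has_period w (smallest_period w) /\
  forall p, has_period w p -> smallest_period w <= p.
Proof.
move=> w0; rewrite /smallest_period.
case: arg_minnP => [|p pw minp]; first exact: has_period_size.
split=> // q qw; have /andP[/andP[_ leq_qw] _] := qw.
by apply: (minp (Ordinal (_ : q < (size w).+1))).
Qed.

Lemma mem_nonempty_factors w x :
  (x \in nonempty_factors w) = (x != [::]) && infix x w.
Proof.
apply/allpairsPdep/andP => [[i [l []]] | [x0 /infixP[y [z ->]]]].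
  rewrite !mem_iota add0n => /andP[_ lti] /andP[l0 ltl] ->; split.
    rewrite -size_eq0 size_take size_drop -lt0n.
    by case: ifP => //; rewrite subn_gt0.
  apply/infixP; exists (take i w), (drop l (drop i w)).
  by rewrite !cat_take_drop.
have sx : 0 < size x by rewrite lt0n size_eq0.
exists (size y), (size x); split.
- by rewrite mem_iota add0n !size_cat -[X in X < _]addn0 ltn_add2l ltn_addr.
- by rewrite mem_iota sx add1n ltnS !size_cat addKn leq_addr.
- by rewrite drop_size_cat // take_size_cat.
Qed.

Lemma conjugatesP w c :
  reflect (exists x y, w = x ++ y /\ c = y ++ x) (c \in conjugates w).
Proof.
apply: (iffP mapP) => [[k _ ->] | [x [y [-> ->]]]].
  by exists (take k w), (drop k w); rewrite cat_take_drop.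
exists (size x); last by rewrite rot_size_cat.
by rewrite mem_iota add0n ltnS size_cat leq_addr.
Qed.

Lemma cce_ub w c x : c \in conjugates w -> x != [::] -> infix x c ->
  (exponent x <= cce w)%R.
Proof.
move=> cw x0 xc; apply: (@le_trans _ _
    (\big[Order.max/0%R]_(y <- nonempty_factors c) exponent y)).
  by apply: le_bigmax_seq => //; rewrite mem_nonempty_factors x0.
by rewrite /cce; apply: (le_bigmax_seq _ c).
Qed.

Lemma cce_attained w : w != [::] -> exists c x,
  [/\ c \in conjugates w, x != [::], infix x c & cce w = exponent x].
Proof.
have mx (T : eqType) (s : seq T) (F : T -> rat) : s != [::] ->
    (forall y : T, 0 <= F y)%R ->
    exists2 y : T, y \in s & (\big[Order.max/0]_(z <- s) F z = F y)%R.
  move=> + F0; elim: s => // a [|b s] IH _.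
    by exists a; rewrite ?mem_head // big_seq1_id max_l.
  have [//|y ys Ey] := IH; rewrite big_cons Ey.
  case: (leP (F a) (F y)) => _; [exists y | exists a] => //.
    by rewrite inE ys orbT.
  by rewrite mem_head.
move=> w0; have e0 x : (0 <= exponent x)%R by rewrite /exponent divr_ge0.
have [||c cw Ec] := mx _ (conjugates w) (fun c =>
    \big[Order.max/0%R]_(x <- nonempty_factors c) exponent x).
- by [].
- by move=> c; elim/big_rec: _ => // i x _ ge0; rewrite le_max ge0 orbT.
have c0 : c != [::].
  have /mapP[k _ ->] := cw.
  by rewrite -size_eq0 size_rot size_eq0.
have [||x xc Ex] := mx _ (nonempty_factors c) exponent.
- have : c \in nonempty_factors c by rewrite mem_nonempty_factors c0 infix_refl.
  by case: (nonempty_factors c).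
- exact: e0.
move: xc; rewrite mem_nonempty_factors => /andP[x0 xc].
by exists c, x; split; rewrite // /cce Ec.
Qed.

End Exponents.

Record dfao (Sigma Delta : finType) := Dfao {
  dfao_state : finType;
  dfao_trans : dfao_state -> Sigma -> dfao_state;
  dfao_init : dfao_state;
  dfao_out : dfao_state -> Delta
}.

Definition dfao_run (Sigma Delta : finType) (M : dfao Sigma Delta)
    (x : seq Sigma) : Delta :=
  dfao_out (foldl (@dfao_trans _ _ M) (dfao_init M) x).

(* Most significant digit first, no leading zeros; base2 0 = [::]. *)
Definition base2 (n : nat) : seq bool :=
  [seq odd (n %/ 2 ^ i)
     | i <- rev (iota 0 (if n == 0 then 0 else (trunc_log 2 n).+1))].

Lemma base2_value n : foldl (fun m (b : bool) => b + m.*2) 0 (base2 n) = n.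
Proof.
have val l m : foldl (fun k (b : bool) => b + k.*2) 0
    [seq odd (m %/ 2 ^ i) | i <- rev (iota 0 l)] = m %% 2 ^ l.
  elim: l m => [|l IH] m; first by rewrite modn1.
  rewrite -[l.+1]add1n iotaD rev_cat map_cat foldl_cat /= divn1.
  rewrite (iotaDl 1) -map_rev -map_comp; under eq_map => i do
    rewrite /= expnD expn1 divnMA divn2.
  have lt : m./2 %% 2 ^ l < 2 ^ l by rewrite ltn_mod expn_gt0.
  have Em : m = m./2 %/ 2 ^ l * 2 ^ (1 + l) + (odd m + (m./2 %% 2 ^ l).*2).
    rewrite expnD expn1 mulnCA addnCA -mul2n -mulnDr -divn_eq mul2n.
    by rewrite odd_double_half.
  rewrite IH [in RHS]Em modnMDl [RHS]modn_small // expnD expn1 mul2n.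
  by case: (odd m); rewrite ?ltn_Sdouble ?ltn_double.
rewrite /base2 val; case: posnP => [-> //| n0].
by rewrite modn_small // trunc_log_ltn.
Qed.

Lemma base2_head n : 0 < n -> head false (base2 n).
Proof.
move=> n0; rewrite /base2 eqn0Ngt n0 -[(trunc_log 2 n).+1]addn1 iotaD rev_cat.
rewrite /= add0n.
have /andP[le lt] := trunc_log_bounds (ltnSn 1) n0.
rewrite (_ : n %/ _ = 1) //; apply/eqP; rewrite eqn_leq.
by rewrite -ltnS ltn_divLR ?expn_gt0 // -expnS lt leq_divRL ?expn_gt0 // mul1n.
Qed.

Definition pad_left (l : nat) (w : seq bool) : seq bool :=
  nseq (l - size w) false ++ w.

Definition base2_pair (n s : nat) : seq (bool * bool) :=
  let l := maxn (size (base2 n)) (size (base2 s)) in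
  zip (pad_left l (base2 n)) (pad_left l (base2 s)).

(* Main.v *)
Require Import Defs.
From mathcomp Require Import all_boot all_order all_algebra.
From mathcomp Require Import zify.

(* Write E = s + n and f(n, s) = cce(t[s..E-1]). Since t is overlap-free, a run of
   exponent above 2 in the circular word must straddle the junction between
   t[..E-1] and t[s..]. Long factors of t determine the parity of their position,
   so matching the run with its translate by the period p gives:
   - f(2n, 2s) = f(n, s), and f(2n, 2s+1) = f(n, s) if t[s] = t[E], because the
     circular word is then (a conjugate of) the image by mu of the shorter one;
   - if n is odd, or if n is even, s is odd and t[s] = t[E-1], a large period
     gives an exponent at most 7/3, resp. 3, whereas the twenty letters
     around the junction always contain a run of period at most 7 reaching this
     bound; so f(n, s) can be read off these twenty letters.
   Hence, for n >= 20, bounded windows of t around s and E together with the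
   value f(n, s) determine the same data for (2n+e, 2s+d). This yields a finite
   automaton with thousands of states, and the 204-state table below is checked,
   by exploring all the reachable data, to be a quotient of it. *)

Set Implicit Arguments.
Unset Strict Implicit.
Unset Printing Implicit Defensive.

Import Order.TTheory GRing.Theory Num.Theory.

Local Notation t := thue_morse.

(** * Runs and matches in the Thue-Morse word *)

Definition run (c : nat -> bool) (i p l : nat) : Prop :=
  forall j, j + p < l -> c (i + j) = c (i + j + p).

(** [c'] is the image of [c] by mu. Two words are allowed, so as to cover both [t] with itself and
    circular words of lengths n and 2n. *)
Definition doubles (c c' : nat -> bool) : Prop :=
  forall k, c' k.*2 = c k /\ c' k.*2.+1 = ~~ c k.

Lemma doubles_block c c' k : doubles c c' -> ~~ odd k -> c' k.+1 = ~~ c' k.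
Proof.
move=> dc ek; rewrite -(even_halfK ek).
by have [-> ->] := dc k./2.
Qed.

(** An odd shift sends odd positions to starts of blocks, so [c'] would alternate on p + 1 letters;
    the first and the last of these, at odd distance p, would then differ. *)
Lemma doubles_odd_run c c' i p l : doubles c c' -> odd p -> p.*2 < l ->
  ~ run c' i p l.
Proof.
move=> dc op ltl rc.
have alt j : j < p -> c' (i + j).+1 = ~~ c' (i + j).
  move=> ltj; case: (boolP (odd (i + j))) => [oj | /(doubles_block dc)//].
  have ej : ~~ odd (i + j + p) by rewrite oddD oj op.
  have := doubles_block dc ej; rewrite -addSn -addnS -!rc; lia.
have par j : j <= p -> c' (i + j) = c' i (+) odd j.
  elim: j => [|j IH] ltj; first by rewrite addn0 addbF.
  by rewrite addnS alt // IH 1?ltnW //= addbN.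
have := par p (leqnn p); have := rc 0; rewrite !addn0 add0n => <-; last by lia.
by rewrite op; case: (c' i).
Qed.

(** Every second letter from i on gives [uphalf l] letters of [c], all complemented when i is
    odd. *)
Lemma doubles_even_run c c' i p l : doubles c c' ->
  run c' i p.*2 l -> run c i./2 p (uphalf l).
Proof.
move=> dc rc j ltj; have := rc j.*2; move: i./2 (odd_double_half i) => h.
case: (odd i) => <-; rewrite ?add0n ?add1n ?addSn -!doubleD.
  by rewrite !(proj2 (dc _)) => /(_ ltac:(lia)) /negb_inj.
by rewrite !(proj1 (dc _)) => -> //; lia.
Qed.

Lemma run_double c c' i p l : doubles c c' ->
  run c i p l -> run c' i.*2 p.*2 l.*2.
Proof.
move=> dc rc j ltj; have {ltj} := rc j./2 ltac:(lia).
move: j./2 (odd_double_half j) => h.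
case: (odd j) => <-; rewrite ?add0n ?add1n ?addnS ?addSn -!doubleD.
  by rewrite !(proj2 (dc _)) => ->.
by rewrite !(proj1 (dc _)).
Qed.

Lemma tm_doubles : doubles t t.
Proof. by case: thue_morse_fixed => _ /mu_fixedP. Qed.

Lemma tm_block k : ~~ odd k -> t k.+1 = ~~ t k.
Proof. exact: doubles_block tm_doubles. Qed.

Lemma tm_no_cube k : t k = t k.+1 -> t k.+1 = t k.+2 -> False.
Proof.
case: (boolP (odd k)) => [ok _ | /tm_block -> + _]; last by case: (t k).
by rewrite (@tm_block k.+1) /= ?ok //; case: (t _).
Qed.

(** Descent on p: odd periods are excluded, and halving an even one keeps the exponent above 2. *)
Lemma tm_overlap_free i p l : 0 < p -> p.*2 < l -> ~ run t i p l.
Proof.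
have [m] := ubnP p; elim: m p i l => // m IH p i l ltp p0 ltl rt.
case: (boolP (odd p)) => [op | ep].
  exact: doubles_odd_run tm_doubles op ltl rt.
move: rt; rewrite -(even_halfK ep) => /(doubles_even_run tm_doubles).
by apply: IH; lia.
Qed.

(** * Matching positions of t and their parity *)

Definition tmatch (i j l : nat) : Prop := forall k, k < l -> t (i + k) = t (j + k).

Lemma tmatch_sym i j l : tmatch i j l -> tmatch j i l.
Proof. by move=> m k /m. Qed.

Lemma tmatch_square i p l : tmatch i (i + p) l -> p < l -> p = 0.
Proof.
move=> m ltp; case: (posnP p) => // p0.
case: (@tm_overlap_free i p p.*2.+1) => // j ltj.
by rewrite m 1?addnAC //; lia.
Qed.

Lemma tmatch_parity2 i j : tmatch i j 2 -> odd i != odd j -> t i.+1 = ~~ t i.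
Proof.
move=> m; have := m 0 isT; have := m 1 isT; rewrite !addn0 !addn1 => E1 E0.
case: (boolP (odd i)) => [_ | /tm_block //] oj.
by rewrite E0 E1 tm_block //; case: (odd j) oj.
Qed.

(** Of two matched adjacent pairs at positions of opposite parity, one is a block of mu. So four
    matched letters would alternate; read from an odd position 2h + 1, this gives t[h] = t[h+1] =
    t[h+2]. *)
Lemma tmatch_parity i j l : tmatch i j l -> odd i != odd j -> l < 4.
Proof.
wlog oi : i j / odd i => [wl m oij|].
  case: (boolP (odd i)) => oi; first exact: wl oi m oij.
  apply: wl (tmatch_sym m) _; last by rewrite eq_sym.
  by move: oij; case: (odd i) oi; case: (odd j).
move=> m; rewrite oi; case: (boolP (odd j)) => // ej _.
rewrite ltnNge; apply/negP => le4.
have m2 k : k < 3 -> t (i + k).+1 = ~~ t (i + k).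
  move=> lt3; case: (boolP (odd (i + k))) => [ok | /tm_block //].
  rewrite -addnS !m ?addnS ?tm_block ?oddD ?(negbTE ej) //; try lia.
have := (m2 0 isT, m2 1 isT, m2 2 isT); rewrite addn0 addn1 addn2.
rewrite -(odd_double_half i) oi add1n => -[[]].
set h := i./2; rewrite -[h.*2.+2]/(h.+1.*2) -[h.*2.+4]/(h.+2.*2).
rewrite !(proj1 (tm_doubles _)) !(proj2 (tm_doubles _)) => E1 _ E3.
apply: (@tm_no_cube h); first by rewrite E1 negbK.
by rewrite E3 negbK.
Qed.

(** For odd i, the letters before t[i] and t[i+p] are complements of equal letters, so the square
    would extend to the left into an overlap. *)
Lemma tmatch_even_square i p : 0 < p -> ~~ odd p -> tmatch i (i + p) p -> ~~ odd i.
Proof.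
move=> p0 ep m; apply/negP; case: i m => // i m oi.
suff /tmatch_square : tmatch i (i + p) p.+1 by move=> /(_ (ltnSn p)); lia.
have m' := m 0 p0; rewrite !addn0 addSn !tm_block ?oddD /= in m'; first last.
- by rewrite -/(odd i.+1).
- by rewrite (negbTE ep) addbF; rewrite -/(odd i.+1).
case=> [_|k ltk]; first by rewrite !addn0; apply: negb_inj.
by rewrite !addnS -!addSn m.
Qed.

Lemma tmatch_half i p l : ~~ odd i -> ~~ odd p ->
  tmatch i (i + p) l -> tmatch i./2 (i./2 + p./2) l./2.
Proof.
move=> ei ep m k ltk; have := m k.*2.
rewrite -{1 2}(even_halfK ei) -{1}(even_halfK ep) -!doubleD.
by rewrite !(proj1 (tm_doubles _)) => -> //; lia.
Qed.

(** * Circular runs and the circular critical exponent *)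

Definition circ (w : seq bool) (k : nat) : bool := nth false w (k %% size w).

(** [circ w] is infinite and periodic; the bound [l <= size w] keeps only the factors of
    conjugates. *)
Definition circ_run (w : seq bool) (p l : nat) : Prop :=
  0 < p <= l /\ l <= size w /\ exists i, run (circ w) i p l.

(** The value is a fraction v.1 / v.2, not necessarily reduced, so that all comparisons are between
    products of naturals. *)
Definition is_cce (w : seq bool) (v : nat * nat) : Prop :=
  [/\ 0 < v.2, forall p l, circ_run w p l -> l * v.2 <= v.1 * p
    & exists p l, circ_run w p l /\ l * v.2 = v.1 * p].

Lemma circ_rot w i k : i <= size w -> circ (rot i w) k = circ w (i + k).
Proof.
move=> lei; rewrite /circ size_rot -modnDmr.
case: (posnP (size w)) => [/size0nil -> | w0]; first by rewrite !nth_nil.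
have: k %% size w < size w by rewrite ltn_mod.
move: (k %% size w) => {}k ltk; rewrite nth_cat size_drop nth_drop.
case: ltnP => le; first by rewrite modn_small //; lia.
rewrite nth_take; last by lia.
have -> : i + k = k - (size w - i) + size w by lia.
by rewrite modnDr modn_small //; lia.
Qed.

Lemma has_periodP (x : seq bool) p :
  reflect (0 < p <= size x /\
           forall j, j + p < size x -> nth false x j = nth false x (j + p))
    (has_period x p).
Proof.
have E j : j < size x -> onth x j = Some (nth false x j).
  by move=> ltj; rewrite onthE (nth_map false).
apply: (iffP andP) => [[-> /forallP h] | [-> h]]; split=> //.
  move=> j ltj; have ltj' : j < size x - p by lia.
  have /eqP := h (Ordinal ltj'); rewrite /= !E; [by case | by lia..].
by apply/forallP => -[j /= ltj]; rewrite !E -?h //; lia.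
Qed.

Lemma circ_run_infix (w : seq bool) p l : circ_run w p l -> exists c x : seq bool,
  [/\ c \in conjugates w, infix x c, size x = l & has_period x p].
Proof.
case=> /andP[p0 lepl] [lel [i ri]].
have w0 : 0 < size w by lia.
have lei : i %% size w <= size w by rewrite ltnW // ltn_mod.
set c := rot (i %% size w) w; exists c, (take l c).
have sz : size (take l c) = l by rewrite size_takel // size_rot.
split; rewrite ?infix_take //.
  by apply/mapP; exists (i %% size w); rewrite // mem_iota add0n ltnS.
have nthc j : j < l -> nth false (take l c) j = circ w (i + j).
  move=> ltj; rewrite nth_take // -[LHS](_ : circ c j = _); last first.
    by rewrite /circ size_rot modn_small //; lia.
  by rewrite circ_rot // /circ modnDml.
apply/has_periodP; rewrite sz; split=> [|j ltj]; first by rewrite p0.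
by rewrite !nthc ?addnA -?ri //; lia.
Qed.

Lemma infix_circ_run (w c x : seq bool) p : c \in conjugates w -> infix x c ->
  has_period x p -> circ_run w p (size x).
Proof.
case/mapP=> i; rewrite mem_iota add0n ltnS => /andP[_ lei] -> xc.
have {xc} [y [z E]] : exists y z : seq bool, rot i w = y ++ x ++ z.
  exact/infixP.
case/has_periodP=> /andP[p0 lep] hp.
have sz : size w = size y + size x + size z.
  by rewrite -(size_rot i) E !size_cat addnA.
split; first by rewrite p0.
split; first by lia.
exists (i + size y) => j ltj.
have nthx k : k < size x -> circ w (i + size y + k) = nth false x k.
  move=> ltk; rewrite -addnA -circ_rot // /circ size_rot modn_small; last by lia.
  rewrite E !nth_cat.
  have -> : (size y + k < size y) = false by lia.
  by rewrite addKn ltk.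
by rewrite -[_ + j + p]addnA !nthx -?hp //; lia.
Qed.

(** A period in [circ_run] may fail to be the smallest one, but the smallest period of the same
    factor only raises the quotient and is itself counted. *)
Lemma cceP (w : seq bool) v : is_cce w v -> cce w = (v.1%:R / v.2%:R)%R.
Proof.
case: v => a b [/= b0 ub [p [l [rpl E]]]].
have [/andP[p0 lepl] [lel _]] := rpl.
have frac_le (l1 p1 l2 p2 : nat) : 0 < p1 -> 0 < p2 -> l1 * p2 <= l2 * p1 ->
    (l1%:R / p1%:R <= l2%:R / p2%:R :> rat)%R.
  move=> p10 p20 le; rewrite ler_pdivrMr ?ltr0n // mulrAC ler_pdivlMr ?ltr0n //.
  by rewrite -!natrM ler_nat.
have w0 : w != [::] by apply: contraTneq lel => ->; rewrite -ltnNge /=; lia.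
apply/eqP; rewrite eq_le; apply/andP; split.
  have [c [x [cw x0 xc ->]]] := cce_attained w0.
  have [hp _] := smallest_periodP x0; have rx := infix_circ_run cw xc hp.
  by apply: frac_le; rewrite ?ub //; case: rx => /andP[].
have [c [x [cw xc sx hx]]] := circ_run_infix rpl.
have x0 : x != [::] by apply: contra_eqN sx => /eqP-> /=; lia.
apply: le_trans (cce_ub cw x0 xc).
have [hp min] := smallest_periodP x0; have := min _ hx.
have /has_periodP[/andP[q0 _] _] := hp; rewrite /exponent sx => leq.
by apply: frac_le => //; rewrite -(leq_pmul2r p0) mulnAC -E; nia.
Qed.

(** * Circular words of Thue-Morse factors *)

Definition factor (s n : nat) : seq bool := [seq t k | k <- iota s n].

Lemma size_factor s n : size (factor s n) = n.
Proof. by rewrite size_map size_iota. Qed.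

Lemma nth_factor s n k : k < n -> nth false (factor s n) k = t (s + k).
Proof. by move=> ltk; rewrite (nth_map 0) ?size_iota // nth_iota. Qed.

Lemma circ_factor s n k : 0 < n -> circ (factor s n) k = t (s + k %% n).
Proof. by move=> n0; rewrite /circ size_factor nth_factor // ltn_mod. Qed.

Lemma circ_factor_double s n : 0 < n ->
  doubles (circ (factor s n)) (circ (factor s.*2 n.*2)).
Proof.
move=> n0 k; rewrite !circ_factor ?double_gt0 //.
have -> : k.*2 %% n.*2 = (k %% n).*2 by rewrite -!muln2 muln_modl.
have -> : k.*2.+1 %% n.*2 = (k %% n).*2.+1.
  rewrite -addn1 -modnDml -!muln2 -muln_modl modn_small ?addn1 //.
  have := ltn_pmod k n0; lia.
by rewrite addnS -!doubleD; exact: tm_doubles.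
Qed.

(** Four letters without two equal neighbours form abab. The exponent is thus at least 2, and runs
    of exponent at most 2 can be set aside later. *)
Lemma circ_run_square s n : 3 < n -> exists2 p, 0 < p & circ_run (factor s n) p p.*2.
Proof.
move=> n4; have c k : k < 4 -> circ (factor s n) k = t (s + k).
  by move=> ltk; rewrite circ_factor ?modn_small //; lia.
have sq1 k : k < 3 -> t (s + k) = t (s + k.+1) -> circ_run (factor s n) 1 2.
  move=> ltk E; split=> //; split; first by rewrite size_factor; lia.
  by exists k => -[|j] ltj; [rewrite addn0 addn1 !c // ltnW | lia].
have [E|N0] := eqVneq (t (s + 0)) (t (s + 1)); first by exists 1 => //; apply: sq1 E.
have [E|N1] := eqVneq (t (s + 1)) (t (s + 2)); first by exists 1 => //; apply: sq1 E.
have [E|N2] := eqVneq (t (s + 2)) (t (s + 3)); first by exists 1 => //; apply: sq1 E.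
exists 2 => //; split=> //; split; first by rewrite size_factor.
exists 0 => -[|[|j]] ltj; [| |by lia]; rewrite !add0n ?add1n !c //.
  by move: N0 N1; case: (t _); case: (t _); case: (t _).
by move: N1 N2; case: (t _); case: (t _); case: (t _).
Qed.

Lemma is_cce_ge2 s n v : 3 < n -> is_cce (factor s n) v -> v.2.*2 <= v.1.
Proof.
move=> n4 [_ ub _]; have [p p0 /ub] := circ_run_square s n4.
by rewrite -(leq_pmul2r p0) -!muln2; nia.
Qed.

(** Above exponent 2, odd periods are impossible, and an even one comes from a run of half the
    period and at least half the length in the shorter word. *)
Lemma is_cce_double s n v : 3 < n -> is_cce (factor s n) v ->
  is_cce (factor s.*2 n.*2) v.
Proof.
move=> n4 cv; have ge2 := is_cce_ge2 n4 cv; have n0 : 0 < n by lia.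
have dc := circ_factor_double s n0.
case: cv => v0 ub [p [l [[/andP[p0 lel] [ln [i ri]]] E]]]; split=> //; last first.
  exists p.*2, l.*2; split; last by rewrite -!mul2n -mulnA E mulnCA.
  split; first by lia.
  split; first by move: ln; rewrite !size_factor; lia.
  by exists i.*2; apply: run_double dc ri.
move=> {p0 lel ln ri E}p {}l [/andP[p0 lel] [ln [{}i ri]]].
case: (leqP l p.*2) => [le2|lt2]; first by nia.
case: (boolP (odd p)) => [op|ep]; first by case: (doubles_odd_run dc op lt2 ri).
rewrite -(even_halfK ep) in ri.
have : circ_run (factor s n) p./2 (uphalf l).
  split; first by lia.
  split; first by move: ln; rewrite !size_factor; lia.
  by exists i./2; apply: doubles_even_run dc ri.
by move/ub; nia.
Qed.

Lemma is_cce_shift w w' v : size w' = size w ->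
  (forall k, circ w' k = circ w k.+1) -> is_cce w v -> is_cce w' v.
Proof.
move=> sz E [v0 ub [p [l [[pl [ln [i ri]]] El]]]].
have per k : circ w (k + size w) = circ w k by rewrite /circ modnDr.
split=> //; last first.
  exists p, l; split=> //; split=> //; split; first by rewrite sz.
  (* This start is i - 1 modulo [size w]. *)
  exists (i + (size w).-1) => j ltj; rewrite !E.
  have -> : (i + (size w).-1 + j).+1 = i + j + size w by lia.
  have -> : (i + (size w).-1 + j + p).+1 = i + j + p + size w by lia.
  by rewrite !per ri.
move=> {pl ln ri El}p {}l [pl [ln [{}i ri]]]; apply: ub; split=> //.
split; first by rewrite -sz.
by exists i.+1 => j /ri; rewrite !E.
Qed.

(** Moving the start from 2s to 2s + 1 drops t[2s] = t[s] and appends t[2s+2n] = t[s+n]; as these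
    agree, the result is a conjugate. *)
Lemma is_cce_doubleS s n v : 3 < n -> t s = t (s + n) ->
  is_cce (factor s n) v -> is_cce (factor s.*2.+1 n.*2) v.
Proof.
move=> n4 E /(is_cce_double n4); apply: is_cce_shift.
  by rewrite !size_factor.
move=> k; rewrite !circ_factor; [|by lia..].
rewrite -[k.+1]addn1 -modnDml.
have ltk : k %% n.*2 < n.*2 by rewrite ltn_mod; lia.
move: (k %% _) ltk => {}k; rewrite leq_eqVlt => /predU1P[Ek | ltk].
  rewrite addn1 Ek modnn addn0.
  have -> : s.*2.+1 + k = (s + n).*2 by lia.
  by rewrite !(proj1 (tm_doubles _)).
by rewrite modn_small ?addn1 ?addnS.
Qed.

(** * Computing maximal exponents *)

Fixpoint lcp (x y : seq bool) : nat :=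
  match x, y with
  | a :: x', b :: y' => if a == b then (lcp x' y').+1 else 0
  | _, _ => 0
  end.

Lemma lcpP x y k : (k <= lcp x y) <->
  [/\ k <= size x, k <= size y & forall j, j < k -> nth false x j = nth false y j].
Proof.
elim: x y k => [|a x IH] [|b y] [|k]; try by split=> // -[].
rewrite /= ; case: eqP => [<- | ne]; last by split=> // -[_ _ /(_ 0 isT)].
rewrite !ltnS IH; split=> -[? ? h]; split=> //.
  by case=> //= j /h.
by move=> j ltj; apply: (h j.+1).
Qed.

(** On z and [drop p z] this is the length of the longest run of period p in z, minus p. *)
Fixpoint max_lcp (x y : seq bool) : nat :=
  match x, y with
  | _ :: x', _ :: y' => maxn (lcp x y) (max_lcp x' y')
  | _, _ => 0
  end.

Lemma max_lcp_ub x y i : lcp (drop i x) (drop i y) <= max_lcp x y.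
Proof.
elim: x y i => [|a x IH] [|b y] [|i] //; first by case: (drop i.+1 (a :: x)).
  by rewrite !drop0 leq_maxl.
by rewrite (leq_trans (IH y i)) // leq_maxr.
Qed.

Lemma max_lcp_attained x y :
  exists2 i, i <= size y & max_lcp x y = lcp (drop i x) (drop i y).
Proof.
elim: x y => [|a x IH] [|b y]; try by exists 0.
have [i lei E] := IH y; rewrite [max_lcp _ _]/= -/(lcp (a :: x) (b :: y)).
case: (leqP (lcp (a :: x) (b :: y)) (max_lcp x y)) => [le | lt].
  by exists i.+1; rewrite // (maxn_idPr le).
by exists 0; rewrite // (maxn_idPl (ltnW lt)).
Qed.

Definition better (v b : nat * nat) : nat * nat :=
  if b.1 * v.2 < v.1 * b.2 then v else b.

Definition best : seq (nat * nat) -> nat * nat := foldr better (0, 1).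

Lemma best_mem (vs : seq (nat * nat)) : best vs = (0, 1) \/ best vs \in vs.
Proof.
elim: vs => [|v vs IH]; first by left.
rewrite /= /better; case: ifP => _; first by right; rewrite mem_head.
by case: IH => [->|m]; [left | right; rewrite inE m orbT].
Qed.

Lemma best_ub (vs : seq (nat * nat)) : (forall v : nat * nat, v \in vs -> 0 < v.2) ->
  0 < (best vs).2 /\
  forall v : nat * nat, v \in vs -> v.1 * (best vs).2 <= (best vs).1 * v.2.
Proof.
elim: vs => [|u vs IH] pos; first by split.
have [|b0 ub] := IH; first by move=> v vv; apply: pos; rewrite inE vv orbT.
have u0 := pos u (mem_head _ _).
rewrite /= /better; case: (ltnP (_ * u.2)) => [lt|le]; split=> // v; rewrite inE.
  case/predU1P=> [-> // | vv]; have := ub v vv.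
  rewrite -(leq_pmul2r u0) => le; rewrite -(leq_pmul2r b0).
  have := leq_mul (ltnW lt) (leqnn v.2); lia.
by case/predU1P=> [-> // | /ub].
Qed.

(** The cap serves for [w ++ w], which has runs longer than w. *)
Definition max_exponent (P cap : nat) (z : seq bool) : nat * nat :=
  best [seq (minn cap (p + max_lcp z (drop p z)), p) | p <- iota 1 P].

Lemma max_exponent_ub P cap z : let v := max_exponent P cap z in
  0 < v.2 /\
  forall i p l, 0 < p <= P -> p <= l <= cap -> i + l <= size z ->
    run (nth false z) i p l -> l * v.2 <= v.1 * p.
Proof.
rewrite /max_exponent; set vs := map _ _.
have [|b0 ub] := @best_ub vs.
  by move=> v /mapP[p + ->] /=; rewrite mem_iota; lia.
split=> // i p l pP pl il ri.
set m := p + max_lcp z (drop p z).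
have lem : l <= m.
  rewrite -leq_subLR (leq_trans _ (max_lcp_ub z (drop p z) i)) //.
  apply/lcpP; rewrite drop_drop !size_drop; split; [lia..|].
  by move=> j ltj; rewrite !nth_drop (addnAC i p) ri //; lia.
have mvs : (minn cap m, p) \in vs.
  by apply/mapP; exists p; rewrite // mem_iota; lia.
apply: leq_trans (ub _ mvs); rewrite leq_mul2r /=.
by apply/orP; right; lia.
Qed.

Lemma max_exponent_attained P cap z : let v := max_exponent P cap z in
  0 < P -> P <= cap -> P <= size z ->
  exists i p l, [/\ 0 < p <= l, l <= cap, i + l <= size z,
    run (nth false z) i p l & l * v.2 = v.1 * p].
Proof.
move=> v P0 Pc Pz; have [b0 ub] := max_exponent_ub P cap z.
have [E | /mapP[p]] :=
    best_mem [seq (minn cap (p + max_lcp z (drop p z)), p) | p <- iota 1 P].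
  (* A single letter has exponent 1, which excludes the default value [(0, 1)]. *)
  have r1 : run (nth false z) 0 1 1 by move=> j; rewrite addn1 ltnS ltn0.
  have := ub 0 1 1 ltac:(lia) ltac:(lia) ltac:(lia) r1.
  by rewrite -[max_exponent _ _ _]/(best _) E.
rewrite mem_iota => pP E; have [i + Em] := max_lcp_attained z (drop p z).
move: E; rewrite size_drop {}Em; set m := lcp _ _ => E iz.
have := leqnn m; rewrite {2}/m => /lcpP[]; rewrite drop_drop !size_drop => m1 m2 h.
exists i, p, (minn cap (p + m)); split; [lia..| |].
  move=> j ltj; have := h j; rewrite !nth_drop (addnAC i p); apply; lia.
by rewrite /v -[max_exponent _ _ _]/(best _) E.
Qed.

Lemma max_exponent_is_cce w : 0 < size w ->
  is_cce w (max_exponent (size w) (size w) (w ++ w)).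
Proof.
move=> w0; have [v0 ub] := max_exponent_ub (size w) (size w) (w ++ w).
have nthww k : k < size w + size w -> nth false (w ++ w) k = circ w k.
  move=> ltk; rewrite nth_cat /circ; case: ltnP => le.
    by rewrite modn_small.
  by rewrite -{2}(subnK le) modnDr modn_small //; lia.
split=> //.
  move=> p l [pl [ln [i ri]]].
  have lti : i %% size w < size w by rewrite ltn_mod.
  apply: (ub (i %% size w)); rewrite ?size_cat; [lia..|] => j ltj.
  rewrite !nthww; [|lia..]; rewrite -addnA.
  have cm k : circ w (i %% size w + k) = circ w (i + k) by rewrite /circ modnDml.
  by rewrite !cm addnA ri.
have [|i [p [l [pl lc il ri E]]]] :=
  max_exponent_attained (z := w ++ w) w0 (leqnn _).
  by rewrite size_cat leq_addr.
exists p, l; split=> //; split=> //; split=> //.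
move: il; rewrite size_cat => il.
by exists i => j ltj; have := ri j ltj; rewrite !nthww //; lia.
Qed.

(** * Runs across the junction *)

(* A run of the circular word that leaves t[s..s+n-1] through its end: it is
   made of t[u..u+a-1], a suffix, followed by t[s..s+b-1], a prefix. *)
Record crossing (s n u p a b : nat) : Prop := Crossing {
  crossing_end : u + a = s + n;
  crossing_left : tmatch u (u + p) (a - p);
  crossing_right : tmatch s (s + p) (b - p);
  crossing_mid : forall j, j < a -> a <= j + p < a + b ->
    t (u + j) = t (s + (j + p - a))
}.

(** Each side is a factor of t, hence overlap-free. *)
Lemma crossing_bounds s n u p a b : 0 < p -> crossing s n u p a b ->
  a <= p.*2 /\ b <= p.*2.
Proof.
move=> p0 [_ L R _]; split; rewrite leqNgt; apply/negP => lt.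
  by have := tmatch_square L; lia.
by have := tmatch_square R; lia.
Qed.

(** Overlap-freeness excludes a run inside t[s..s+n-1], and [l <= n] one that crosses the junction
    twice. *)
Lemma circ_run_crossing s n i p l : 0 < n -> 0 < p -> p.*2 < l -> l <= n ->
  run (circ (factor s n)) i p l ->
  exists a b, [/\ 0 < a, 0 < b, a + b = l, i %% n + a = n
    & crossing s n (s + i %% n) p a b].
Proof.
move=> n0 p0 ltl ln ri; have lti := ltn_pmod i n0; set i0 := i %% n.
have c1 j : i0 + j < n -> circ (factor s n) (i + j) = t (s + i0 + j).
  by move=> lt; rewrite circ_factor // -modnDml modn_small // addnA.
have c2 j : n <= i0 + j < n + n -> circ (factor s n) (i + j) = t (s + (i0 + j - n)).
  move=> /andP[le lt]; rewrite circ_factor // -modnDml -/i0 -{1}(subnK le).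
  by rewrite modnDr modn_small //; lia.
case: (leqP (i0 + l) n) => [le|lt].
  case: (@tm_overlap_free (s + i0) p l) => // j ltj.
  by have := ri j ltj; rewrite -addnA !c1 ?addnA //; lia.
exists (n - i0), (l - (n - i0)); split; [lia.. |split; first by lia].
- move=> k ltk; have := ri k.
  rewrite -[i + k + p]addnA !c1; [|lia..] => ->; last by lia.
  by congr (t _); lia.
- move=> k ltk; have := ri (n - i0 + k).
  rewrite -[i + _ + p]addnA !c2; [|lia..] => E; have {}E := E ltac:(lia).
  have -> : s + k = s + (i0 + (n - i0 + k) - n) by lia.
  by rewrite E; congr (t _); lia.
- move=> j ltj le; have := ri j; rewrite -[i + j + p]addnA c1 ?c2; [|lia..].
  by move=> ->; [congr (t _); lia | lia].
Qed.

(** * Reading the value off the letters around the junction *)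

Definition junction (s n : nat) : seq bool := factor (s + n - 10) 10 ++ factor s 10.

Lemma nth_junction s n k : 20 <= n -> k < 20 ->
  nth false (junction s n) k = circ (factor s n) (n - 10 + k).
Proof.
move=> n20 ltk; rewrite nth_cat size_factor circ_factor; last by lia.
case: ltnP => le; first by rewrite nth_factor // modn_small; [congr (t _)|]; lia.
rewrite nth_factor; last by lia.
have -> : n - 10 + k = k - 10 + n by lia.
by rewrite modnDr modn_small //; lia.
Qed.

(** A run better than v >= 2 would cross the junction; by the last hypothesis it would lie within
    ten letters on each side and have period at most 7, where v is already maximal. *)
Lemma junction_is_cce s n v : v = max_exponent 7 20 (junction s n) ->
  20 <= n -> v.2.*2 <= v.1 ->
  (forall u p a b, 0 < p -> p.*2 < a + b -> v.1 * p < (a + b) * v.2 ->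
     crossing s n u p a b -> [/\ p <= 7, a <= 10 & b <= 10]) ->
  is_cce (factor s n) v.
Proof.
move=> Ev n20 v2 small; have sz : size (junction s n) = 20.
  by rewrite size_cat !size_factor.
have := max_exponent_ub 7 20 (junction s n); rewrite -Ev => -[v0 ub].
split=> //; last first.
  have := @max_exponent_attained 7 20 (junction s n); rewrite -Ev sz.
  case=> // i [p [l [pl lc il ri E]]].
  exists p, l; split=> //; split=> //; split; first by rewrite size_factor; lia.
  exists (n - 10 + i) => j ltj; have := ri j ltj.
  by rewrite !nth_junction ?addnA //; lia.
move=> p l [/andP[p0 pl]]; rewrite size_factor => -[ln [i ri]].
rewrite leqNgt; apply/negP => lt.
have lt2 : p.*2 < l by rewrite -(ltn_pmul2r v0); nia.
have n0 : 0 < n by lia.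
have [a [b [a0 b0 El Ei cr]]] := circ_run_crossing n0 p0 lt2 ln ri.
have [p7 a10 b10] : [/\ p <= 7, a <= 10 & b <= 10].
  by apply: small cr => //; rewrite El.
suff : l * v.2 <= v.1 * p by rewrite leqNgt lt.
(* The junction word begins ten letters before the end of the factor, hence the offset 10 - a. *)
apply: (ub (10 - a)); rewrite ?sz; [lia..|].
move=> j ltj; rewrite !nth_junction; [|lia..].
have cm k : circ (factor s n) (n - 10 + (10 - a + k)) = circ (factor s n) (i + k).
  rewrite !circ_factor // -[in RHS]modnDml; congr (t (s + _ %% n)); lia.
by rewrite -[_ + j + p]addnA !cm ri ?addnA.
Qed.

(** * Parity bounds on crossing runs *)

Lemma crossing_odd_period s n u p a b : 0 < p -> odd p ->
  crossing s n u p a b -> a <= p + 3 /\ b <= p + 3.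
Proof.
move=> p0 op [_ L R _].
have := tmatch_parity L; have := tmatch_parity R.
by rewrite !oddD op; lia.
Qed.

(** If a, b > p, the first a + b - 2p letters of the run lie in the suffix and their translates by
    2p in the prefix. The positions differ by the odd number n - 2p, so there are at most three such
    letters. *)
Lemma crossing_odd_odd s n u p a b : 0 < p -> odd p -> odd n ->
  crossing s n u p a b -> a + b <= p.*2 + 3.
Proof.
move=> p0 op on cr; have [a2 b2] := crossing_bounds p0 cr.
have [a3 b3] := crossing_odd_period p0 op cr; case: cr => Eu L R X.
case: (leqP a p) => [|lta]; first by lia.
case: (leqP b p) => [|ltb]; first by lia.
have m : tmatch (s + p - (a - p)) u (a - p + (b - p)).
  move=> k ltk; case: (ltnP k (a - p)) => [lt|le].
    have -> : s + p - (a - p) + k = s + (p + k + p - a) by lia.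
    by rewrite L // -[u + p + k]addnA X //; lia.
  have -> : s + p - (a - p) + k = s + p + (k - (a - p)) by lia.
  rewrite -R ?X; [congr (t _); lia | lia..].
by have := tmatch_parity m; lia.
Qed.

Lemma tm_pair_boundary h : t h.+1 = ~~ t h -> t h.*2.+1 = t h.*2.+2.
Proof.
move=> E; rewrite -[h.*2.+2]/(h.+1.*2) (proj2 (tm_doubles _)).
by rewrite (proj1 (tm_doubles _)) E.
Qed.

(** Halving gives a square of period 3 at h = s/2. This odd shift makes t[h], t[h+1], t[h+2]
    alternate, so their images meet in double letters. *)
Lemma tm_square6 s : tmatch s (s + 6) 6 ->
  t (s + 1) = t (s + 2) /\ t (s + 3) = t (s + 4).
Proof.
move=> m; have es := @tmatch_even_square s 6 isT isT m.
have := @tmatch_half s 6 6 es isT m; rewrite -{3 4 5 6}(even_halfK es).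
move: s./2 => h {m es} /= m.
have m2 k : k < 2 -> t (h + k).+1 = ~~ t (h + k).
  move=> ltk; apply: (@tmatch_parity2 _ (h + 3 + k)); last by rewrite !oddD; lia.
  by move=> j ltj; have := m (k + j) ltac:(lia); rewrite !addnA.
have /tm_pair_boundary E0 := m2 0 isT; have /tm_pair_boundary E1 := m2 1 isT.
move: E0 E1; rewrite addn0 addn1 => E0 E1.
by rewrite addn1 addn2 addn3 addn4.
Qed.

(** Halving gives a square of period 4, which starts at an even position again; the two letters of
    each of its blocks differ, so their images meet in a double letter. *)
Lemma tm_square8 s : tmatch s (s + 8) 8 ->
  t (s + 1) = t (s + 2) /\ t (s + 5) = t (s + 6).
Proof.
move=> m; have es := @tmatch_even_square s 8 isT isT m.
have := @tmatch_half s 8 8 es isT m; rewrite -{3 4 5 6}(even_halfK es).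
move: s./2 => h {m es} /= m.
have eh := @tmatch_even_square h 4 isT isT m.
have /tm_pair_boundary E0 := tm_block eh.
have /tm_block/tm_pair_boundary E2 : ~~ odd h.+2 by rewrite /= negbK.
by rewrite addn1 addn2 (addnS _ 4) (addnS _ 5) (addnS _ 4) addn4.
Qed.

(** The shift by p matches min(a, b, p) letters of the suffix with letters of the prefix, at
    positions differing by the odd number n - p. *)
Lemma crossing_even_odd s n u p a b : 0 < p -> ~~ odd p -> odd n ->
  p.*2 < a + b -> crossing s n u p a b -> p <= 2 \/ minn a b <= 3 /\ p < maxn a b.
Proof.
move=> p0 ep on lt cr; have [a2 b2] := crossing_bounds p0 cr.
case: cr => Eu L R X.
have m : tmatch (u + (a - p)) (s + (p - a)) (minn (minn a b) p).
  move=> k ltk; rewrite -addnA X; [congr (t _); lia | lia..].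
have := tmatch_parity m; lia.
Qed.

Lemma crossing_odd_small s n u p a b : 0 < p -> odd n -> 7 * p < 3 * (a + b) ->
  crossing s n u p a b -> [/\ p <= 7, a <= 10 & b <= 10].
Proof.
move=> p0 on lt cr; have [a2 b2] := crossing_bounds p0 cr.
case: (boolP (odd p)) => [op|ep].
  have := crossing_odd_odd p0 op on cr.
  have [] := crossing_odd_period p0 op cr; split; lia.
have lt2 : p.*2 < a + b by lia.
have near := crossing_even_odd p0 ep on lt2 cr.
case: (leqP p 4) => [p4 | lt4]; first by split; lia.
(* One side has at most 3 letters and the other at most 2p, so 7p < 3(a + b) forces p < 9. For p = 6
   and p = 8 it also forces exactly 3 letters on one side and a full square on the other. *)
have p68 : p = 6 \/ p = 8 by lia.
case: cr => Eu L R X; case: (leqP a 3) => a3.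
  have {}a3 : a = 3 by lia.
  have {}R : tmatch s (s + p) p by move=> k ltk; apply: R; lia.
  (* These two letters also occur at u, with the other parity, so they differ; the square makes them
     equal. *)
  have : t (s + (p - 3)).+1 = ~~ t (s + (p - 3)).
    apply: (@tmatch_parity2 _ u).
      move=> k ltk; rewrite X; [congr (t _)|..]; lia.
    have := tmatch_even_square p0 ep R; lia.
  rewrite -addnS; case: p68 R => -> /=.
    by case/tm_square6 => _ ->; case: (t _).
  by case/tm_square8 => _ ->; case: (t _).
have b3 : b = 3 by lia.
have {}L : tmatch u (u + p) p by move=> k ltk; apply: L; lia.
have : t (u + 1).+1 = ~~ t (u + 1).
  apply: (@tmatch_parity2 _ (s + 1)).
    move=> k ltk; rewrite -!addnA L; last by lia.
    rewrite -!addnA X; [congr (t _)|..]; lia.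
  have := tmatch_even_square p0 ep L; lia.
rewrite -addnS; case: p68 L => -> /=.
  by case/tm_square6 => -> _; case: (t _).
by case/tm_square8 => -> _; case: (t _).
Qed.

Lemma odd_is_cce s n v : v = max_exponent 7 20 (junction s n) ->
  20 <= n -> odd n -> 7 * v.2 <= 3 * v.1 -> is_cce (factor s n) v.
Proof.
move=> Ev n20 on v7; apply: (junction_is_cce Ev) => //; first by lia.
move=> u p a b p0 _ lt; apply: crossing_odd_small => //.
have := max_exponent_ub 7 20 (junction s n); rewrite -Ev => -[v0 _].
by rewrite -(ltn_pmul2r v0); nia.
Qed.

(** Exponent above 3 forces a, b > p. For odd p, the last p letters before the junction match the p
    letters after it at opposite parities, so p <= 3. *)
Lemma broken_is_cce s n v : v = max_exponent 7 20 (junction s n) ->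
  20 <= n -> ~~ odd n -> odd s -> t s = t (s + n).-1 -> 3 * v.2 <= v.1 ->
  is_cce (factor s n) v.
Proof.
move=> Ev n20 en os Es v3; apply: (junction_is_cce Ev) => //; first by lia.
move=> u p a b p0 _ ltv cr.
have := max_exponent_ub 7 20 (junction s n); rewrite -Ev => -[v0 _].
have lt : 3 * p < a + b by rewrite -(ltn_pmul2r v0); nia.
have [a2 b2] := crossing_bounds p0 cr; case: cr => Eu L R X.
case: (boolP (odd p)) => [op|ep].
  have m : tmatch (u + (a - p)) s p.
    by move=> k ltk; rewrite -addnA X; [congr (t _)|..]; lia.
  by have := tmatch_parity m; split; lia.
(* The equal letters t[s+n-1] and t[s], adjacent in the circular word, would
   reoccur at distance p as the two letters of a block. *)
have e : ~~ odd (u + (a - p.+1)) by lia.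
have := tm_block e; rewrite L; last by lia.
have -> : u + p + (a - p.+1) = (s + n).-1 by lia.
rewrite -Es -addnS X; [|lia..].
have -> : s + ((a - p.+1).+1 + p - a) = s by lia.
by case: (t s).
Qed.

(** * The automaton *)

Lemma take_factor s n m : m <= n -> take m (factor s n) = factor s m.
Proof. by move=> le; rewrite -map_take take_iota (minn_idPl le). Qed.

Lemma drop_factor s n m : drop m (factor s n) = factor (s + m) (n - m).
Proof. by rewrite -map_drop drop_iota addnC. Qed.

Lemma morph_mu_factor s n : morph mu (factor s n) = factor s.*2 n.*2.
Proof.
elim: n s => // n IH s.
rewrite -[factor s n.+1]/(t s :: factor s.+1 n) -cat1s /morph map_cat flatten_cat.
rewrite -/(morph mu (factor _ _)) IH /= -[factor s.*2 _]/(_ :: _ :: factor _ _).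
by rewrite (proj1 (tm_doubles s)) (proj2 (tm_doubles s)).
Qed.

(* What is known of t[s..s+n-1]: inl W with W = t[s..s+n+1] when n < 20, else
   inr (L, R, v) with L = t[s..s+9], R = t[s+n-10..s+n+1] and cce value v. *)
Definition context : Type := (seq bool + seq bool * seq bool * (nat * nat))%type.

Definition describes (n s : nat) (c : context) : Prop :=
  match c with
  | inl W => n < 20 /\ W = factor s n.+2
  | inr (L, R, v) => [/\ 20 <= n, L = factor s 10, R = factor (s + n - 10) 12
                       & is_cce (factor s n) v]
  end.

(* From the value v at (n, s) to the value at (2n + e, 2s + d), whose windows
   are L and R; the flag eq says whether t[s] = t[s+n]. The bounds 7/3 and 3 are
   those under which periods above 7 do not matter. *)
Definition next_value (e d eq : bool) (v : nat * nat) (L R : seq bool) :=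
  if ~~ e && (~~ d || eq) then Some v else
  let v' := max_exponent 7 20 (take 10 R ++ L) in
  if (if e then 7 * v'.2 <= 3 * v'.1 else 3 * v'.2 <= v'.1) then Some v' else None.

Definition word_exponent (w : seq bool) : nat * nat :=
  max_exponent (size w) (size w) (w ++ w).

(** The windows reach two letters past the end of the factor. The morphism doubles this margin to
    four and e + d uses up at most two, so the margin is preserved. *)
Definition extend (c : context) (e d : bool) : option context :=
  match c with
  | inl W =>
      let n := size W - 2 in
      let n' := e + n.*2 in
      let W' := take n'.+2 (drop d (morph mu W)) in
      if n' < 20 then Some (inl W') else
      let L := take 10 W' in
      let R := drop (n' - 10) W' in
      omap (fun v => inr (L, R, v))
        (next_value e d (nth false W 0 == nth false W n)
           (word_exponent (take n W)) L R)
  | inr (L, R, v) =>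
      let L' := take 10 (drop d (morph mu L)) in
      let R' := take 12 (drop (10 + (e + d)) (morph mu R)) in
      omap (fun v => inr (L', R', v))
        (next_value e d (nth false L 0 == nth false R 10) v L' R')
  end.

Lemma next_value_sound n s (e d : bool) v v' :
  let n' := e + n.*2 in let s' := d + s.*2 in
  20 <= n' -> 3 < n -> is_cce (factor s n) v ->
  next_value e d (t s == t (s + n)) v (factor s' 10) (factor (s' + n' - 10) 12)
    = Some v' ->
  is_cce (factor s' n') v'.
Proof.
move=> n' s' n20 n4 cv; rewrite /next_value take_factor //.
rewrite -/(junction s' n') /s'; move: n20; rewrite /n' => {n' s'} n20.
move Eu: (max_exponent _ _ _) => u.
case: e d n20 Eu => [] d n20 Eu.
  case: ifP => // v7 [<-]; apply: (odd_is_cce (esym Eu)) => //; lia.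
case: d n20 Eu => n20 Eu /=; last by case=> <-; apply: is_cce_double.
case: eqP => [E [<-] | /eqP NE]; first by apply: is_cce_doubleS.
case: ifP => // v3 [<-]; apply: (broken_is_cce (esym Eu)) => //; [lia..|].
(* The end letters are t[2s+1], the complement of t[s], and t[2s+2n] = t[s+n]; they agree because
   t[s] and t[s+n] differ. *)
rewrite !add0n add1n addSn -doubleD.
rewrite (proj1 (tm_doubles _)) (proj2 (tm_doubles _)).
by move: NE; case: (t s); case: (t _).
Qed.

Lemma extend_sound n s c (e d : bool) c' :
  describes n s c -> extend c e d = Some c' ->
  describes (e + n.*2) (d + s.*2) c'.
Proof.
case: c => [W [n20 ->] | [[L R] v] [n20 -> -> cv]].
  rewrite /extend size_factor subn2 -[n.+2.-2]/n morph_mu_factor drop_factor.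
  rewrite take_factor; last by lia.
  rewrite !nth_factor // ?addn0.
  have -> : s.*2 + d = d + s.*2 by lia.
  case: ltnP => [lt [<-] // | le].
  rewrite take_factor ?drop_factor ?take_factor; [|lia..].
  have -> : (e + n.*2).+2 - (e + n.*2 - 10) = 12 by lia.
  have -> : d + s.*2 + (e + n.*2 - 10) = d + s.*2 + (e + n.*2) - 10 by lia.
  case E: next_value => [v'|] // [<-]; split=> //.
  apply: next_value_sound E; [by []|lia|].
  have := @max_exponent_is_cce (factor s n); rewrite /word_exponent size_factor.
  by apply; lia.
rewrite /extend !nth_factor // ?addn0 !morph_mu_factor !drop_factor.
rewrite !take_factor; [|lia..].
have -> : s + n - 10 + 10 = s + n by lia.
have -> : s.*2 + d = d + s.*2 by lia.
have -> : (s + n - 10).*2 + (10 + (e + d)) = d + s.*2 + (e + n.*2) - 10 by lia.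
case E: next_value => [v'|] // [<-]; split=> //; first by lia.
by apply: next_value_sound E => //; lia.
Qed.

(* Row q lists the successors of q on (0,0), (0,1), (1,0), (1,1). The outputs of
   states 0 and 1, reached only when n = 0, are arbitrary. *)
Definition transitions : seq (seq nat) := [::
  [:: 0; 1; 2; 3]; [:: 0; 0; 4; 4]; [:: 5; 6; 7; 8]; [:: 9; 10; 11; 12];
  [:: 5; 13; 14; 15]; [:: 16; 17; 18; 19]; [:: 20; 21; 22; 23];
  [:: 24; 25; 26; 27]; [:: 28; 29; 21; 30]; [:: 31; 32; 26; 33];
  [:: 31; 34; 35; 36]; [:: 37; 38; 39; 40]; [:: 41; 42; 43; 44];
  [:: 20; 45; 46; 47]; [:: 24; 48; 35; 36]; [:: 49; 11; 50; 51];
  [:: 37; 52; 53; 54]; [:: 55; 45; 46; 47]; [:: 56; 57; 35; 36];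
  [:: 58; 59; 50; 51]; [:: 16; 17; 18; 60]; [:: 61; 38; 62; 63];
  [:: 64; 65; 35; 36]; [:: 66; 17; 18; 60]; [:: 41; 67; 43; 68];
  [:: 69; 70; 45; 71]; [:: 61; 72; 73; 74]; [:: 75; 76; 77; 78];
  [:: 41; 42; 79; 44]; [:: 24; 34; 35; 36]; [:: 80; 81; 79; 44];
  [:: 41; 67; 79; 68]; [:: 69; 70; 45; 82]; [:: 75; 76; 77; 83];
  [:: 69; 29; 21; 84]; [:: 61; 52; 85; 86]; [:: 55; 21; 22; 23];
  [:: 16; 17; 87; 88]; [:: 89; 21; 90; 91]; [:: 92; 93; 26; 27];
  [:: 30; 94; 21; 84]; [:: 31; 25; 26; 27]; [:: 28; 70; 45; 82];
  [:: 95; 72; 62; 96]; [:: 75; 76; 97; 83]; [:: 61; 98; 53; 99];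
  [:: 64; 100; 26; 33]; [:: 56; 100; 26; 33]; [:: 69; 29; 21; 30];
  [:: 37; 98; 101; 102]; [:: 103; 104; 35; 36]; [:: 105; 17; 18; 60];
  [:: 89; 45; 46; 47]; [:: 106; 107; 35; 36]; [:: 82; 108; 50; 51];
  [:: 109; 17; 18; 60]; [:: 110; 111; 79; 68]; [:: 112; 22; 21; 30];
  [:: 113; 98; 101; 102]; [:: 114; 38; 39; 40]; [:: 58; 108; 50; 51];
  [:: 109; 17; 18; 19]; [:: 106; 115; 26; 27]; [:: 84; 116; 21; 84];
  [:: 110; 111; 43; 68]; [:: 112; 22; 21; 84]; [:: 113; 52; 53; 54];
  [:: 28; 70; 45; 58]; [:: 75; 76; 97; 78]; [:: 41; 42; 117; 44];
  [:: 24; 32; 26; 33]; [:: 95; 98; 101; 102]; [:: 89; 21; 22; 23];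
  [:: 118; 119; 26; 27]; [:: 120; 121; 21; 122]; [:: 123; 124; 26; 33];
  [:: 123; 125; 35; 36]; [:: 126; 38; 127; 128]; [:: 129; 130; 131; 44];
  [:: 132; 72; 62; 96]; [:: 133; 93; 26; 27]; [:: 30; 134; 45; 82];
  [:: 132; 98; 101; 102]; [:: 135; 136; 131; 44]; [:: 129; 130; 79; 44];
  [:: 118; 137; 35; 36]; [:: 138; 108; 50; 51]; [:: 139; 140; 35; 36];
  [:: 141; 59; 50; 51]; [:: 142; 17; 18; 60]; [:: 143; 144; 35; 36];
  [:: 145; 17; 18; 60]; [:: 80; 146; 43; 68]; [:: 147; 134; 45; 71];
  [:: 92; 148; 35; 36]; [:: 149; 17; 87; 88]; [:: 84; 116; 21; 122];
  [:: 132; 38; 127; 128]; [:: 89; 45; 150; 151]; [:: 82; 152; 50; 51];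
  [:: 112; 46; 45; 82]; [:: 92; 153; 35; 36]; [:: 71; 152; 50; 51];
  [:: 154; 155; 79; 68]; [:: 156; 157; 21; 84]; [:: 158; 52; 53; 54];
  [:: 129; 159; 43; 68]; [:: 160; 116; 21; 30]; [:: 161; 38; 39; 40];
  [:: 126; 52; 53; 54]; [:: 56; 162; 26; 27]; [:: 163; 46; 45; 58];
  [:: 110; 164; 117; 44]; [:: 66; 17; 87; 88]; [:: 165; 17; 87; 88];
  [:: 160; 166; 45; 71]; [:: 106; 167; 35; 36]; [:: 113; 72; 62; 96];
  [:: 135; 168; 43; 68]; [:: 169; 170; 45; 71]; [:: 135; 136; 79; 44];
  [:: 118; 125; 35; 36]; [:: 171; 172; 79; 44]; [:: 135; 168; 79; 68];
  [:: 169; 170; 45; 82]; [:: 169; 121; 21; 84]; [:: 109; 17; 87; 88];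
  [:: 173; 174; 26; 27]; [:: 122; 175; 21; 84]; [:: 176; 115; 26; 27];
  [:: 84; 166; 45; 82]; [:: 177; 72; 62; 96]; [:: 178; 17; 87; 88];
  [:: 80; 146; 79; 68]; [:: 92; 179; 26; 33]; [:: 123; 119; 26; 27];
  [:: 120; 170; 45; 82]; [:: 169; 121; 21; 30]; [:: 126; 98; 101; 102];
  [:: 180; 181; 79; 68]; [:: 182; 90; 21; 30]; [:: 183; 98; 101; 102];
  [:: 184; 52; 53; 54]; [:: 180; 181; 43; 68]; [:: 182; 90; 21; 84];
  [:: 183; 52; 53; 54]; [:: 30; 134; 45; 58]; [:: 80; 81; 117; 44];
  [:: 147; 94; 21; 84]; [:: 95; 52; 53; 54]; [:: 143; 185; 26; 33];
  [:: 139; 185; 26; 33]; [:: 184; 38; 39; 40]; [:: 147; 94; 21; 30];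
  [:: 103; 186; 26; 27]; [:: 187; 188; 45; 58]; [:: 154; 189; 117; 44];
  [:: 190; 104; 35; 36]; [:: 105; 17; 87; 88]; [:: 84; 166; 45; 58];
  [:: 129; 130; 117; 44]; [:: 191; 17; 87; 88]; [:: 112; 46; 45; 71];
  [:: 110; 164; 79; 44]; [:: 163; 46; 45; 82]; [:: 114; 52; 53; 54];
  [:: 106; 192; 26; 33]; [:: 160; 116; 21; 84]; [:: 120; 170; 45; 58];
  [:: 135; 136; 117; 44]; [:: 118; 124; 26; 33]; [:: 193; 174; 26; 27];
  [:: 122; 194; 45; 82]; [:: 171; 195; 43; 68]; [:: 196; 194; 45; 71];
  [:: 173; 197; 35; 36]; [:: 129; 159; 79; 68]; [:: 198; 17; 87; 88];
  [:: 132; 52; 53; 54]; [:: 147; 134; 45; 82]; [:: 139; 199; 26; 27];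
  [:: 200; 150; 45; 58]; [:: 180; 201; 117; 44]; [:: 145; 17; 87; 88];
  [:: 142; 17; 87; 88]; [:: 182; 150; 45; 82]; [:: 156; 188; 45; 71];
  [:: 154; 189; 79; 44]; [:: 190; 202; 26; 33]; [:: 187; 188; 45; 82];
  [:: 154; 155; 43; 68]; [:: 161; 52; 53; 54]; [:: 160; 166; 45; 82];
  [:: 171; 195; 79; 68]; [:: 173; 203; 26; 33]; [:: 122; 194; 45; 58];
  [:: 171; 172; 117; 44]; [:: 196; 175; 21; 84]; [:: 177; 52; 53; 54];
  [:: 182; 150; 45; 71]; [:: 180; 201; 79; 44]; [:: 200; 150; 45; 82];
  [:: 156; 188; 45; 82]; [:: 196; 194; 45; 82]].

Definition outputs : seq (nat * nat) := [::
  (1, 1); (1, 1); (1, 1); (1, 1); (1, 1); (1, 1); (2, 1); (2, 1); (2, 1);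
  (1, 1); (1, 1); (2, 1); (2, 1); (2, 1); (2, 1); (2, 1); (2, 1); (3, 1);
  (5, 2); (5, 2); (2, 1); (3, 1); (5, 2); (5, 2); (2, 1); (2, 1); (3, 1);
  (3, 1); (2, 1); (2, 1); (7, 3); (2, 1); (2, 1); (3, 1); (2, 1); (3, 1);
  (3, 1); (2, 1); (4, 1); (7, 3); (7, 3); (2, 1); (2, 1); (7, 3); (3, 1);
  (3, 1); (5, 2); (5, 2); (2, 1); (2, 1); (7, 2); (7, 2); (4, 1); (8, 3);
  (8, 3); (3, 1); (5, 2); (5, 2); (5, 2); (10, 3); (5, 2); (3, 1); (8, 3);
  (8, 3); (5, 2); (5, 2); (5, 2); (2, 1); (3, 1); (2, 1); (2, 1); (7, 3);
  (4, 1); (3, 1); (3, 1); (3, 1); (3, 1); (3, 1); (8, 3); (8, 3); (7, 3);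
  (7, 3); (8, 3); (3, 1); (8, 3); (3, 1); (3, 1); (13, 5); (13, 5); (4, 1);
  (13, 5); (13, 5); (7, 3); (7, 3); (7, 3); (7, 3); (8, 3); (8, 3); (4, 1);
  (8, 3); (5, 2); (7, 3); (7, 3); (7, 2); (7, 2); (7, 2); (8, 3); (8, 3);
  (11, 3); (3, 1); (5, 2); (5, 2); (5, 2); (5, 2); (10, 3); (8, 3); (8, 3);
  (5, 2); (3, 1); (3, 1); (3, 1); (3, 1); (17, 7); (3, 1); (3, 1); (3, 1);
  (3, 1); (17, 7); (17, 7); (8, 3); (8, 3); (17, 7); (8, 3); (7, 3); (7, 3);
  (3, 1); (3, 1); (3, 1); (3, 1); (13, 5); (13, 5); (13, 5); (4, 1); (13, 5);
  (13, 5); (13, 5); (7, 3); (7, 3); (7, 3); (7, 3); (13, 5); (13, 5); (4, 1);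
  (7, 3); (7, 2); (7, 2); (7, 2); (7, 2); (7, 2); (8, 3); (8, 3); (11, 3);
  (5, 2); (5, 2); (5, 2); (10, 3); (8, 3); (8, 3); (3, 1); (3, 1); (3, 1);
  (17, 7); (17, 7); (17, 7); (17, 7); (17, 7); (8, 3); (17, 7); (8, 3);
  (7, 3); (13, 5); (13, 5); (13, 5); (13, 5); (4, 1); (13, 5); (7, 2); (7, 2);
  (7, 2); (7, 2); (7, 2); (11, 3); (8, 3); (17, 7); (17, 7); (17, 7); (17, 7);
  (17, 7); (17, 7); (13, 5); (13, 5); (13, 5); (7, 2); (17, 7)].

Definition next_state (q : nat) (a : bool * bool) : nat :=
  nth 0 (nth [::] transitions q) (a.1.*2 + a.2).

Definition output (q : nat) : nat * nat := nth (0, 1) outputs q.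

(** * Search of the reachable contexts *)

Definition entry : Type := (context * nat)%type.

Inductive trie := Leaf | Node of seq entry & trie & trie.

Fixpoint lookup (k : seq bool) (T : trie) : seq entry :=
  match T, k with
  | Leaf, _ => [::]
  | Node es _ _, [::] => es
  | Node _ l r, b :: k' => lookup k' (if b then r else l)
  end.

Fixpoint insert (k : seq bool) (x : entry) (T : trie) : trie :=
  match k with
  | [::] => if T is Node es l r then Node (x :: es) l r else Node [:: x] Leaf Leaf
  | b :: k' =>
      let: (es, l, r) :=
        if T is Node es l r then (es, l, r) else ([::], Leaf, Leaf) in
      if b then Node es l (insert k' x r) else Node es (insert k' x l) r
  end.

Fixpoint entries (T : trie) : seq entry :=
  if T is Node es l r then es ++ entries l ++ entries r else [::].

Lemma lookup_entries k T x : x \in lookup k T -> x \in entries T.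
Proof.
elim: T k => [|es l IHl r IHr] [|b k] //=; rewrite !mem_cat; first by move=> ->.
by case: b => [/IHr | /IHl] ->; rewrite !orbT.
Qed.

(** Entries that differ only in the value or the state share a node and are told apart in its
    list. *)
Definition key (c : context) : seq bool :=
  match c with inl W => W | inr (L, R, _) => L ++ R end.

Definition stored (T : trie) (x : entry) : bool := x \in lookup (key x.1) T.

Definition letters : seq (bool * bool) :=
  [:: (false, false); (false, true); (true, false); (true, true)].

Definition successors (x : entry) : seq entry :=
  pmap (fun a => omap (fun c => (c, next_state x.2 a)) (extend x.1 a.1 a.2)) letters.

(** Only the outcome of the search is checked, by [closed]; a failing [extend], dropped by
    [successors], is detected there. *)
Fixpoint explore (fuel : nat) (todo : seq entry) (T : trie) : trie :=
  if fuel is fuel'.+1 then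
    if todo is x :: todo' then
      if stored T x then explore fuel' todo' T
      else explore fuel' (successors x ++ todo') (insert (key x.1) x T)
    else T
  else T.

Definition initial : entry := (inl [:: false; true], 0).

Definition reachable : trie := explore (120 * 100) [:: initial] Leaf.

Definition same_ratio (v o : nat * nat) : bool :=
  (0 < o.2) && (v.1 * o.2 == o.1 * v.2).

(** [size W <= 2] means n = 0, where the output is free. Demanding that [extend] succeed verifies
    the bounds 7/3 and 3 at every stored context. *)
Definition entry_ok (T : trie) (x : entry) : bool :=
  match x.1 with
  | inl W => (size W <= 2) ||
      same_ratio (word_exponent (take (size W - 2) W)) (output x.2)
  | inr (_, v) => same_ratio v (output x.2)
  end &&
  all (fun a => if extend x.1 a.1 a.2 is Some c
                then stored T (c, next_state x.2 a) else false) letters.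

Definition closed (T : trie) : bool :=
  stored T initial && all (entry_ok T) (entries T).

Lemma reachable_closed : closed reachable.
Proof. by vm_cast_no_check (erefl true). Qed.

Arguments factor : simpl never.
Arguments max_exponent : simpl never.

Lemma closed_entry_ok T x : closed T -> x \in entries T -> entry_ok T x.
Proof. by case/andP=> _ /allP ok /ok. Qed.

Lemma closed_extend T c q a : closed T -> (c, q) \in entries T ->
  exists2 c', extend c a.1 a.2 = Some c' & (c', next_state q a) \in entries T.
Proof.
move=> cT /(closed_entry_ok cT)/andP[_ /allP/(_ a)].
have -> : a \in letters by case: a => [[] []].
rewrite [(c, q).1]/=.
case: extend => [c' /(_ isT) st|/(_ isT)//]; exists c' => //.
exact: lookup_entries st.
Qed.

(** * Reading the digits, and the resulting automaton *)

Definition shift_in (m : nat * nat) (a : bool * bool) : nat * nat :=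
  (a.1 + m.1.*2, a.2 + m.2.*2).

(** Induction on the last digit pair, since reading (e, d) turns (n, s) into (2n + e, 2s + d). *)
Lemma closed_describes T x : closed T -> exists2 c,
  let m := foldl shift_in (0, 0) x in describes m.1 m.2 c &
  (c, foldl next_state 0 x) \in entries T.
Proof.
move=> cT; elim/last_ind: x => [|x a [c dc cq]].
  by exists (inl [:: false; true]); last by case/andP: cT => /lookup_entries.
rewrite !foldl_rcons; have [c' Ec cq'] := closed_extend a cT cq.
by exists c' => //; apply: extend_sound dc Ec.
Qed.

Lemma foldl_shift_in x y m1 m2 : size x = size y ->
  foldl shift_in (m1, m2) (zip x y) =
  (foldl (fun m (b : bool) => b + m.*2) m1 x,
   foldl (fun m (b : bool) => b + m.*2) m2 y).
Proof. by elim: x y m1 m2 => [|b x IH] [|b' y] //= m1 m2 [/IH->]. Qed.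

Lemma base2_pair_value n s : foldl shift_in (0, 0) (base2_pair n s) = (n, s).
Proof.
have pad l w : foldl (fun m (b : bool) => b + m.*2) 0 (pad_left l w) =
    foldl (fun m (b : bool) => b + m.*2) 0 w.
  by rewrite foldl_cat; congr (foldl _ _ _); elim: (_ - _).
rewrite foldl_shift_in ?pad ?base2_value //.
by rewrite !size_cat !size_nseq !subnK ?leq_maxl ?leq_maxr.
Qed.

Lemma same_ratioP v o : 0 < v.2 -> same_ratio v o ->
  (v.1%:R / v.2%:R = o.1%:R / o.2%:R :> rat)%R.
Proof.
move=> v0 /andP[o0 /eqP E]; apply/eqP; rewrite eqr_div ?pnatr_eq0 -?lt0n //.
by rewrite -!natrM E.
Qed.

Lemma entry_ok_cce T n s c q : 0 < n -> describes n s c -> entry_ok T (c, q) ->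
  cce (factor s n) = ((output q).1%:R / (output q).2%:R)%R.
Proof.
move=> n0 dc /andP[+ _]; case: c dc => [W [_ ->] | [[L R] v] [_ _ _ cv]].
  rewrite /= size_factor subn2 -[n.+2.-2]/n take_factor; last by lia.
  have -> : (n.+2 <= 2) = false by lia.
  have := @max_exponent_is_cce (factor s n); rewrite /word_exponent size_factor.
  move/(_ n0); move: (max_exponent _ _ _) => v cv.
  by move/(same_ratioP _) <-; [exact: cceP | case: cv].
by move/(same_ratioP _) <-; [exact: cceP | case: cv].
Qed.

(** This makes [inord] faithful in [cce_dfao]; accesses outside the table give 0. *)
Lemma transitions_bound q a : next_state q a < 204.
Proof.
have ok : all (all (fun m => m < 204)) transitions by vm_compute.
rewrite /next_state; set i := _ + _; set row := nth [::] _ _.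
have row_ok : all (fun m => m < 204) row.
  have [lt|le] := ltnP q (size transitions); first exact: (all_nthP _ ok).
  by rewrite /row nth_default.
have [lt|le] := ltnP i (size row); last by rewrite nth_default.
exact: (all_nthP _ row_ok).
Qed.

Definition cce_output (q : 'I_204) : rat :=
  ((output q).1%:R / (output q).2%:R)%R.

(** The finite output alphabet is the image of [cce_output]. *)
Definition cce_dfao : dfao (bool * bool)%type (seq_sub (codom cce_output)) :=
  @Dfao (bool * bool)%type (seq_sub (codom cce_output)) 'I_204
    (fun q a => inord (next_state q a)) ord0
    (fun q => SeqSub (codom_f cce_output q)).

Lemma cce_dfao_run x : val (dfao_run cce_dfao x) =
  let o := output (foldl next_state 0 x) in (o.1%:R / o.2%:R)%R.
Proof.
have E : foldl (@dfao_trans _ _ cce_dfao) ord0 x = foldl next_state 0 x :> nat.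
  elim/last_ind: x => // x a IH; rewrite !foldl_rcons -IH.
  by rewrite inordK // transitions_bound.
by rewrite -E.
Qed.

Theorem theorem10 :
  exists (D : seq rat) (M : dfao (bool * bool)%type (seq_sub D)),
    #|dfao_state M| = 204 /\
    forall n s : nat, 1 <= n ->
      val (dfao_run M (base2_pair n s)) = cce (block thue_morse s (s + n - 1)).
Proof.
exists (codom cce_output), cce_dfao; split=> [|n s n0]; first exact: card_ord.
have -> : block t s (s + n - 1) = factor s n.
  by rewrite /block (_ : _.+1 - s = n) //; lia.
have [c] := closed_describes (base2_pair n s) reachable_closed.
rewrite base2_pair_value cce_dfao_run => dc cq.
by rewrite (entry_ok_cce n0 dc (closed_entry_ok reachable_closed cq)).
Qed.
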